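(* Let $\mathcal{F}$ be a discourse sheaf on a finite graph $G=(V,E)$ with finite-dimensional stalks, let $x\in C^0(G;\mathcal{F})$ be a fixed $0$-cochain, let $\mathcal{I}\subseteq\{(v,e):v\unlhd e\}$ be a set of adapting incidences, and let $A:V_{\mathrm{maps}}\to W$ and $c\in W$ be the associated discrepancy operator and constant. Let $\rho_0\in V_{\mathrm{maps}}$ be the configuration of adapting restriction maps of $\mathcal{F}$ and let $\beta>0$. Then the gradient flow of $\mathcal{J}(\rho)=\frac12\|A\rho+c\|^2$, $$\frac{d\rho}{dt}=-\beta A^T(A\rho(t)+c),\qquad \rho(0)=\rho_0,$$ admits a unique global solution, which converges exponentially to $$\rho^\infty=\rho_0-A^\dagger d_0,\qquad d_0=A\rho_0+c .$$ The limiting maps $\rho^\infty$, together with the fixed (non-adapting) restriction maps, define a sheaf $\mathcal{F}^\infty$ that is the Frobenius-nearest to $\mathcal{F}$ among all sheaves (with the same stalks and the same fixed restriction maps) minimizing the discrepancy on $E'$; that is, $\rho^\infty$ is the element of $\{\rho\in V_{\mathrm{maps}}:\rho \text{ minimizes } \|A\rho+c\|\}$ nearest to $\rho_0$. If $-c\in\mathrm{im}(A)$, then $\mathcal{F}^\infty$ achieves zero discrepancy on all adapting edges, i.e. $A\rho^\infty+c=0$; otherwise it minimizes the residual $\|A\rho+c\|$.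
   Context: A discourse sheaf (cellular sheaf) $\mathcal{F}$ on a graph $G=(V,E)$ assigns a finite-dimensional real inner product space $\mathcal{F}(v)$ to each vertex, $\mathcal{F}(e)$ to each edge, and a linear restriction map $\mathcal{F}_{v\unlhd e}:\mathcal{F}(v)\to\mathcal{F}(e)$ to each incidence $v\in e$ (written $v\unlhd e$). $C^0(G;\mathcal{F})=\bigoplus_v\mathcal{F}(v)$. The maps $\mathcal{F}_{v\unlhd e}$ with $(v,e)\notin\mathcal{I}$ are held fixed. $V_{\mathrm{maps}}=\bigoplus_{(v,e)\in\mathcal{I}}\mathrm{Hom}(\mathcal{F}(v),\mathcal{F}(e))$ with the Frobenius inner product. $E'\subseteq E$ is the set of edges with at least one adapting incidence (''adapting edges''), and $W=\bigoplus_{e\in E'}\mathcal{F}(e)$ with the direct-sum inner product. Fix an orientation of each edge and let $\sigma_{w,e}=+1$ if $w$ is the head of $e$ and $-1$ if $w$ is its tail. For $e\in E'$, $$(A\rho)_e=\sum_{(w,e)\in\mathcal{I}}\sigma_{w,e}\,\rho_{w\unlhd e}(x_w),\qquad c_e=\sum_{(w,e)\notin\mathcal{I}}\sigma_{w,e}\,\mathcal{F}_{w\unlhd e}(x_w),$$ where the sums run over the endpoints $w$ of $e$. The discrepancy on adapting edges is $A\rho+c$. $A^T$ is the adjoint and $A^\dagger$ the Moore–Penrose pseudoinverse of $A$. *)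

(* Defs.v *)
From HB Require Import structures.
From mathcomp Require Import all_boot all_order all_algebra.
From mathcomp Require Import all_classical all_reals all_analysis.
From mathcomp Require Import ring.

Set Implicit Arguments.
Unset Strict Implicit.
Unset Printing Implicit Defensive.

Import Order.TTheory GRing.Theory Num.Theory.
Import numFieldNormedType.Exports.
Local Open Scope ring_scope.

(* The norm (hence the topology) is the one induced by the inner product. *)
HB.mixin Record NormedModule_hasInner (R : realType) V
    of NormedModule R V & Vector R V := {
  dotp : V -> V -> R ;
  dotpC : forall u v, dotp u v = dotp v u ;
  dotpP : forall w, linear_for *%R (dotp^~ w) ;
  dotp_norm : forall u, dotp u u = `|u| ^+ 2
}.

#[short(type="euclidType")]
HB.structure Definition Euclid (R : realType) :=
  { V of NormedModule_hasInner R V & NormedModule R V & Vector R V }.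

HB.factory Record Vector_isEuclid (R : realType) V of Vector R V := {
  dotp : V -> V -> R ;
  dotpC : forall u v, dotp u v = dotp v u ;
  dotpP : forall w, linear_for *%R (dotp^~ w) ;
  dotp_gt0 : forall u, u != 0 -> 0 < dotp u u
}.

HB.builders Context R V of Vector_isEuclid R V.

Let dotDl u v w : dotp (u + v) w = dotp u w + dotp v w.
Proof. by have := dotpP w 1 u v; rewrite scale1r mul1r. Qed.

Let dot0l w : dotp 0 w = 0.
Proof. by apply: (addrI (dotp 0 w)); rewrite -dotDl !addr0. Qed.

Let dotZl a u w : dotp (a *: u) w = a * dotp u w.
Proof. by have := dotpP w a u 0; rewrite addr0 dot0l addr0. Qed.

Let dotDr u v w : dotp w (u + v) = dotp w u + dotp w v.
Proof. by rewrite dotpC dotDl !(dotpC w). Qed.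

Let dotZr a u w : dotp w (a *: u) = a * dotp w u.
Proof. by rewrite dotpC dotZl (dotpC w). Qed.

Let dot_ge0 u : 0 <= dotp u u.
Proof. by have [->|/dotp_gt0/ltW//] := eqVneq u 0; rewrite dot0l. Qed.

Let CauchySchwarz u v : dotp u v ^+ 2 <= dotp u u * dotp v v.
Proof.
have [->|v0] := eqVneq v 0; first by rewrite dotpC !dot0l expr0n mulr0.
have vv := dotp_gt0 v0.
set t := - (dotp u v / dotp v v).
have := dot_ge0 (u + t *: v).
have -> : dotp (u + t *: v) (u + t *: v) =
          dotp u u - dotp u v ^+ 2 / dotp v v.
  rewrite dotDl !dotDr !dotZl !dotZr (dotpC v u) /t.
  have : dotp v v != 0 by rewrite gt_eqF.
  move: (dotp u v) (dotp v v) (dotp u u) => a b c b0.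
  by field.
by rewrite subr_ge0 ler_pdivrMr.
Qed.

Let enorm u := Num.sqrt (dotp u u).

Let enormD u v : enorm (u + v) <= enorm u + enorm v.
Proof.
rewrite -(@ler_pXn2r _ 2) ?nnegrE ?addr_ge0 ?sqrtr_ge0 //.
rewrite sqrrD !sqr_sqrtr // dotDl !dotDr (dotpC v u).
rewrite -!addrA lerD2l !addrA lerD2r -mulr2n ler_wMn2r // -sqrtrM //.
apply: le_trans (ler_norm _) _; rewrite -sqrtr_sqr ler_sqrt ?mulr_ge0 //.
Qed.

Let enormZ a u : enorm (a *: u) = `|a| * enorm u.
Proof. by rewrite /enorm dotZl dotZr mulrA -expr2 sqrtrM ?sqr_ge0 // sqrtr_sqr. Qed.

Let enorm0_eq0 u : enorm u = 0 -> u = 0.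
Proof.
move=> /eqP; rewrite sqrtr_eq0 => u0; apply/eqP; apply: contraTT u0 => /dotp_gt0.
by rewrite -ltNge.
Qed.

HB.instance Definition _ := Lmodule_isNormed.Build R V enormD enormZ enorm0_eq0.

Let enorm_sqr (u : V) : dotp u u = `|u| ^+ 2.
Proof. by rewrite sqr_sqrtr. Qed.

HB.instance Definition _ := NormedModule_hasInner.Build R V dotpC dotpP enorm_sqr.

HB.end.

Section InnerTheory.
Variables (R : realType) (V : euclidType R).
Implicit Types (u v w : V) (U : {vspace V}).

Lemma dotpDl u v w : dotp (u + v) w = dotp u w + dotp v w.
Proof. by have := dotpP w 1 u v; rewrite scale1r mul1r. Qed.

Lemma dotp0l w : dotp 0 w = 0.
Proof. by apply: (addrI (dotp 0 w)); rewrite -dotpDl !addr0. Qed.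

Lemma dotpZl a u w : dotp (a *: u) w = a * dotp u w.
Proof. by have := dotpP w a u 0; rewrite addr0 dotp0l addr0. Qed.

Lemma dotpDr u v w : dotp w (u + v) = dotp w u + dotp w v.
Proof. by rewrite dotpC dotpDl !(dotpC w). Qed.

Lemma dotp0r w : dotp w 0 = 0.
Proof. by rewrite dotpC dotp0l. Qed.

Lemma dotpZr a u w : dotp w (a *: u) = a * dotp w u.
Proof. by rewrite dotpC dotpZl (dotpC w). Qed.

Lemma dotpBl u v w : dotp (u - v) w = dotp u w - dotp v w.
Proof. by rewrite dotpDl -scaleN1r dotpZl mulN1r. Qed.

Lemma dotpBr u v w : dotp w (u - v) = dotp w u - dotp w v.
Proof. by rewrite dotpC dotpBl !(dotpC w). Qed.

Lemma dotp_suml I (r : seq I) (P : pred I) (F : I -> V) w :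
  dotp (\sum_(i <- r | P i) F i) w = \sum_(i <- r | P i) dotp (F i) w.
Proof. by apply: (big_morph (dotp^~ w)) => [u v|]; rewrite ?dotpDl ?dotp0l. Qed.

Lemma dotp_sumr I (r : seq I) (P : pred I) (F : I -> V) w :
  dotp w (\sum_(i <- r | P i) F i) = \sum_(i <- r | P i) dotp w (F i).
Proof. by rewrite dotpC dotp_suml; apply: eq_bigr => i _; rewrite dotpC. Qed.

Lemma dotp_ge0 u : 0 <= dotp u u.
Proof. by rewrite dotp_norm sqr_ge0. Qed.

Lemma dotp_eq0 u : (dotp u u == 0) = (u == 0).
Proof. by rewrite dotp_norm sqrf_eq0 normr_eq0. Qed.

Lemma dotpI u v : (forall w, dotp u w = dotp v w) -> u = v.
Proof.
by move=> uv; apply/eqP; rewrite -subr_eq0 -dotp_eq0 dotpBl uv subrr.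
Qed.

Definition orthonormal_basis U (b : (\dim U).-tuple V) : Prop :=
  basis_of U b /\ forall i j : 'I_(\dim U), dotp b`_i b`_j = (i == j)%:R.

Let orthonormal_free n (b : n.-tuple V) :
  (forall i j : 'I_n, dotp b`_i b`_j = (i == j)%:R) -> free b.
Proof.
move=> bP; apply/freeP => k k0 i.
have : dotp (\sum_(j < n) k j *: b`_j) b`_i = 0 by rewrite k0 dotp0l.
rewrite dotp_suml (bigD1 i) //= dotpZl bP eqxx mulr1 big1 ?addr0 // => j ji.
by rewrite dotpZl bP (negPf ji) mulr0.
Qed.

Let gram_schmidt U n : (n <= \dim U)%N -> exists b : n.-tuple V,
  (forall i : 'I_n, b`_i \in U) /\
  (forall i j : 'I_n, dotp b`_i b`_j = (i == j)%:R).
Proof.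
elim: n => [_|n IHn ltnU]; first by exists [tuple] ; split=> -[].
have [b [bU bP]] := IHn (ltnW ltnU).
have [v vU vb] : exists2 v, v \in U & v \notin <<b>>%VS.
  apply/subvPn; apply: contraTN ltnU => /dimvS; rewrite -leqNgt => le.
  by apply: leq_trans le _; rewrite -{2}(size_tuple b) dim_span.
pose w := v - \sum_(i < n) dotp b`_i v *: b`_i.
have w0 : w != 0.
  apply: contraNneq vb => /eqP; rewrite subr_eq0 => /eqP ->.
  by apply: memv_suml => i _; rewrite memvZ // memv_span // mem_nth // size_tuple.
have wU : w \in U by rewrite memvB // memv_suml // => i _; rewrite memvZ.
have wb (i : 'I_n) : dotp w b`_i = 0.
  rewrite dotpBl dotp_suml (bigD1 i) //= dotpZl bP eqxx mulr1 dotpC.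
  by rewrite big1 ?addr0 ?subrr // => j ji; rewrite dotpZl bP (negPf ji) mulr0.
pose u := `|w|^-1 *: w.
have uu : dotp u u = 1.
  by rewrite dotpZl dotpZr dotp_norm mulrA -invfM -expr2 mulVf // sqrf_eq0 normr_eq0.
have ub (i : 'I_n) : dotp u b`_i = 0 by rewrite dotpZl wb mulr0.
have sb : size b = n by rewrite size_tuple.
have ordP (k : 'I_n.+1) : (exists2 k' : 'I_n, k = k' :> nat & (k < n)%N) \/ k = n :> nat.
  have := ltn_ord k; rewrite ltnS leq_eqVlt => /orP[/eqP|lt]; first by right.
  by left; exists (Ordinal lt).
exists [tuple of rcons b u]; split=> [i|i j]; rewrite /= !nth_rcons sb.
  case: (ordP i) => [[i' ei lti]|ei]; first by rewrite lti ei bU.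
  by rewrite ei ltnn eqxx memvZ.
case: (ordP i) => [[i' ei lti]|ei]; case: (ordP j) => [[j' ej ltj]|ej].
- by rewrite lti ltj ei ej bP -!val_eqE /= ei ej.
- by rewrite lti -val_eqE /= ej ltnn eqxx ltn_eqF // ei dotpC ub.
- by rewrite ltj -val_eqE /= ei ltnn eqxx gtn_eqF // ej ub.
- by rewrite -val_eqE /= ei ej ltnn eqxx uu.
Qed.

Lemma orthonormal_basis_exists U : exists b, @orthonormal_basis U b.
Proof.
have [b [bU bP]] := gram_schmidt (leqnn (\dim U)).
exists b; split=> //; rewrite basisEfree orthonormal_free //= size_tuple leqnn andbT.
by apply/span_subvP => _ /tnthP[i ->]; rewrite (tnth_nth 0).
Qed.

Definition onb U : (\dim U).-tuple V := sval (cid (orthonormal_basis_exists U)).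

Lemma onbP U : orthonormal_basis (onb U).
Proof. exact: svalP (cid (orthonormal_basis_exists U)). Qed.

Lemma onb_expand U (b : (\dim U).-tuple V) v : orthonormal_basis b -> v \in U ->
  v = \sum_(i < \dim U) dotp b`_i v *: b`_i.
Proof.
move=> [bU bP] vU; rewrite {1}(coord_basis bU vU); apply: eq_bigr => i _.
congr (_ *: _); rewrite [in RHS](coord_basis bU vU) dotp_sumr (bigD1 i) //=.
rewrite dotpZr bP eqxx mulr1 big1 ?addr0 // => j ji.
by rewrite dotpZr bP eq_sym (negPf ji) mulr0.
Qed.

End InnerTheory.

Section Frobenius.
Variables (R : realType) (U V : euclidType R).
Implicit Types f g h : 'Hom(U, V).

(* tr (f^* g), computed in an orthonormal basis of U; see [frobE] for the
   independence of the choice of the basis. *)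
Definition frob f g : R :=
  \sum_(i < \dim {:U}) dotp (f (onb {:U})`_i) (g (onb {:U})`_i).

Lemma frobE (b : (\dim {:U}).-tuple U) f g : orthonormal_basis b ->
  frob f g = \sum_(i < \dim {:U}) dotp (f b`_i) (g b`_i).
Proof.
move=> bP; have cP := onbP {:U}; set c := onb {:U} in cP *.
rewrite /frob -/c.
transitivity (\sum_(i < \dim {:U}) \sum_(j < \dim {:U})
    dotp b`_j c`_i * dotp (f b`_j) (g c`_i)).
  apply: eq_bigr => i _.
  rewrite {1}(onb_expand bP (memvf c`_i)) linear_sum dotp_suml.
  by apply: eq_bigr => j _; rewrite linearZ dotpZl.
rewrite exchange_big /=; apply: eq_bigr => j _.
rewrite [X in _ = dotp _ (g X)](onb_expand cP (memvf b`_j)) linear_sum.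
rewrite dotp_sumr; apply: eq_bigr => i _.
by rewrite linearZ dotpZr dotpC.
Qed.

Let frobC f g : frob f g = frob g f.
Proof. by apply: eq_bigr => i _; rewrite dotpC. Qed.

Let frobP h : linear_for *%R (frob^~ h).
Proof.
move=> a f g; rewrite /frob mulr_sumr -big_split /=; apply: eq_bigr => i _.
by rewrite !lfunE /= lfunE /= dotpDl dotpZl.
Qed.

Let frob_gt0 f : f != 0 -> 0 < frob f f.
Proof.
move=> f0; rewrite lt_def sumr_ge0 ?andbT => [|i _]; last exact: dotp_ge0.
apply: contraNneq f0 => /eqP.
rewrite psumr_eq0 => [/allP f0|i _]; last exact: dotp_ge0.
apply/eqP/lfunP => u; rewrite lfunE /=.
rewrite (onb_expand (onbP {:U}) (memvf u)) linear_sum big1 // => i _.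
have := f0 i (mem_index_enum i); rewrite dotp_eq0 => /eqP fi.
by rewrite linearZ /= fi scaler0.
Qed.

HB.instance Definition _ :=
  Vector_isEuclid.Build R 'Hom(U, V) frobC frobP frob_gt0.

Lemma dotp_homE f g : dotp f g = frob f g.
Proof. by []. Qed.

Definition adjoint f : 'Hom(V, U) :=
  linfun (fun w : V => \sum_(i < \dim {:U}) dotp (f (onb {:U})`_i) w *: (onb {:U})`_i).

Lemma adjointP f u w : dotp (f u) w = dotp u (adjoint f w).
Proof.
have lin : linear (fun w : V =>
    \sum_(i < \dim {:U}) dotp (f (onb {:U})`_i) w *: (onb {:U})`_i).
  move=> a x y; rewrite scaler_sumr -big_split /=; apply: eq_bigr => i _.
  by rewrite dotpDr dotpZr scalerDl scalerA.
pose m := GRing.isLinear.Build R V U *:%R _ lin.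
pose L : {linear V -> U} := HB.pack (fun w : V =>
    \sum_(i < \dim {:U}) dotp (f (onb {:U})`_i) w *: (onb {:U})`_i) m.
have -> : adjoint f w = L w by rewrite /adjoint (lfunE L).
rewrite /= {1}(onb_expand (onbP {:U}) (memvf u)) linear_sum dotp_suml dotp_sumr.
by apply: eq_bigr => i _; rewrite linearZ dotpZl dotpZr mulrC (dotpC u).
Qed.

End Frobenius.

Lemma adjoint_uniq (R : realType) (U V : euclidType R) (f : 'Hom(U, V)) (g : 'Hom(V, U)) :
  (forall u w, dotp (f u) w = dotp u (g w)) -> adjoint f = g.
Proof.
by move=> fg; apply/lfunP => w; apply: dotpI => u; rewrite dotpC -adjointP fg dotpC.
Qed.

Section OrthogonalProjection.
Variables (R : realType) (V : euclidType R) (U : {vspace V}).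

Definition oproj_fun (v : V) : V := \sum_(i < \dim U) dotp (onb U)`_i v *: (onb U)`_i.

Let oproj_linear : linear oproj_fun.
Proof.
move=> a x y; rewrite scaler_sumr -big_split /=; apply: eq_bigr => i _.
by rewrite dotpDr dotpZr scalerDl scalerA.
Qed.

HB.instance Definition _ := GRing.isLinear.Build R V V *:%R oproj_fun oproj_linear.

Definition oproj : 'End(V) := linfun oproj_fun.

Lemma oproj_mem v : oproj v \in U.
Proof.
have [bU _] := onbP U; rewrite lfunE; apply: memv_suml => i _; apply: memvZ.
by rewrite (basis_mem bU) // mem_nth // size_tuple.
Qed.

Lemma oproj_id v : v \in U -> oproj v = v.
Proof. by move=> vU; rewrite lfunE [RHS](onb_expand (onbP U) vU). Qed.

Lemma oproj_sym u v : dotp (oproj u) v = dotp u (oproj v).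
Proof.
rewrite !lfunE dotp_suml dotp_sumr; apply: eq_bigr => i _.
by rewrite dotpZl dotpZr mulrC (dotpC u).
Qed.

End OrthogonalProjection.

Section PseudoInverse.
Variables (R : realType) (U V : euclidType R).
Implicit Types (f : 'Hom(U, V)) (g : 'Hom(V, U)).
Local Open Scope lfun_scope.

Definition is_mpinv f g : Prop :=
  [/\ f \o g \o f = f, g \o f \o g = g,
      adjoint (f \o g) = f \o g & adjoint (g \o f) = g \o f].

Definition mpinv f : 'Hom(V, U) := xget 0 [set g | is_mpinv f g]%classic.

Lemma mpinvP f : is_mpinv f (mpinv f).
Proof.
rewrite /mpinv; apply: (@xgetPex _ 0 [set g | is_mpinv f g]%classic).
pose P := oproj (limg f); pose Q := \1 - oproj (lker f).
have QEu u : Q u = u - oproj (lker f) u by rewrite add_lfunE opp_lfunE id_lfunE.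
have fQ u : f (Q u) = f u.
  rewrite QEu linearB /= (_ : f (oproj _ u) = 0) ?subr0 //.
  by apply/eqP; rewrite -memv_ker oproj_mem.
have Qsym u v : dotp (Q u) v = dotp u (Q v).
  by rewrite !QEu dotpBl dotpBr oproj_sym.
have QK u : f u = 0 -> Q u = 0.
  by move=> /eqP; rewrite -memv_ker => uK; rewrite QEu oproj_id // subrr.
have QE u v : f u = f v -> Q u = Q v.
  move=> /eqP; rewrite -subr_eq0 -linearB => /eqP /QK; rewrite linearB => /eqP.
  by rewrite subr_eq0 => /eqP.
have fV w : w \in limg f -> f (f^-1 w) = w by exact: limg_lfunVK.
have [g fgE [gfE Qg]] : exists2 g : 'Hom(V, U), forall w, f (g w) = P w &
    (forall u, g (f u) = Q u) /\ (forall w, Q (g w) = g w).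
  exists (Q \o f^-1 \o P); [|split] => x; rewrite !comp_lfunE.
  - by rewrite fQ fV // oproj_mem.
  - by rewrite oproj_id ?memv_img ?memvf //; apply: QE; rewrite fV ?memv_img ?memvf.
  - by apply: QE; rewrite fQ.
exists g; split.
- by apply/lfunP => u; rewrite !comp_lfunE gfE fQ.
- by apply/lfunP => w; rewrite !comp_lfunE gfE Qg.
- apply: adjoint_uniq => u w; rewrite !comp_lfunE !fgE; exact: oproj_sym.
- apply: adjoint_uniq => u w; rewrite !comp_lfunE !gfE; exact: Qsym.
Qed.

Lemma mpinv_uniq f g : is_mpinv f g -> mpinv f = g.
Proof.
move: (mpinv f) (mpinvP f) => h [fhf hfh fh hf] [fgf gfg fg gf].
have sVV k : adjoint (f \o k) = f \o k ->
    forall u v, dotp (f (k u)) v = dotp u (f (k v)).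
  by move=> kk u v; rewrite -!(comp_lfunE f k) adjointP kk.
have sUU k : adjoint (k \o f) = k \o f ->
    forall u v, dotp (k (f u)) v = dotp u (k (f v)).
  by move=> kk u v; rewrite -!(comp_lfunE k f) adjointP kk.
have fhfE u : f (h (f u)) = f u by rewrite -[in RHS]fhf !comp_lfunE.
have fgfE u : f (g (f u)) = f u by rewrite -[in RHS]fgf !comp_lfunE.
have E1 w : f (h w) = f (g w).
  by apply: dotpI => v; rewrite -(fgfE (h w)) (sVV _ fg) (sVV _ fh) fhfE -(sVV _ fg).
have E2 u : h (f u) = g (f u).
  by apply: dotpI => v; rewrite -[X in dotp (h X) _](fgfE u) (sUU _ hf) (sUU _ gf) fhfE -(sUU _ gf).
apply/lfunP => w; rewrite -{1}hfh -gfg !comp_lfunE.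
by rewrite E2 E1.
Qed.

End PseudoInverse.

Section DirectSum.
Import VectorInternalTheory.
Variables (R : realType) (I : finType) (T : I -> euclidType R).

Definition dsum : Type := {dffun forall i, T i}.

HB.instance Definition _ := Choice.copy dsum {dffun forall i, T i}.

Implicit Types f g h : dsum.

Let dzero : dsum := [ffun i => 0].
Let dopp f : dsum := [ffun i => - f i].
Let dadd f g : dsum := [ffun i => f i + g i].
Let dscale (a : R) f : dsum := [ffun i => a *: f i].

Let daddA : associative dadd.
Proof. by move=> f g h; apply/ffunP => i; rewrite !ffunE addrA. Qed.
Let daddC : commutative dadd.
Proof. by move=> f g; apply/ffunP => i; rewrite !ffunE addrC. Qed.
Let dadd0 : left_id dzero dadd.
Proof. by move=> f; apply/ffunP => i; rewrite !ffunE add0r. Qed.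
Let daddN : left_inverse dzero dopp dadd.
Proof. by move=> f; apply/ffunP => i; rewrite !ffunE addNr. Qed.

HB.instance Definition _ := GRing.isZmodule.Build dsum daddA daddC dadd0 daddN.

Let dscaleA a b f : dscale a (dscale b f) = dscale (a * b) f.
Proof. by apply/ffunP => i; rewrite !ffunE scalerA. Qed.
Let dscale1 : left_id 1 dscale.
Proof. by move=> f; apply/ffunP => i; rewrite !ffunE scale1r. Qed.
Let dscaleDr : right_distributive dscale +%R.
Proof. by move=> a f g; apply/ffunP => i; rewrite !ffunE scalerDr. Qed.
Let dscaleDl f : {morph dscale^~ f : a b / a + b}.
Proof. by move=> a b; apply/ffunP => i; rewrite !ffunE scalerDl. Qed.

HB.instance Definition _ :=
  GRing.Zmodule_isLmodule.Build R dsum dscaleA dscale1 dscaleDr dscaleDl.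

Let J : finType := {i : I & 'I_(dim (T i))}.

Let dsum_vect_axiom : Vector.axiom #|J| dsum.
Proof.
exists (fun f : dsum => \row_(j < #|J|)
  v2r (f (tag (enum_val j))) 0 (tagged (enum_val j))).
  by move=> a f g; apply/rowP => j; rewrite !mxE !ffunE linearP !mxE.
exists (fun r : 'rV[R]_#|J| => [ffun i => r2v (\row_(k < dim (T i))
    r 0 (enum_rank (Tagged (fun i => 'I_(dim (T i))) k))) ] : dsum).
  move=> f; apply/ffunP => i; rewrite ffunE -[RHS]v2rK; congr r2v.
  by apply/rowP => k; rewrite !mxE enum_rankK.
move=> r; apply/rowP => j; rewrite mxE ffunE r2vK mxE.
by congr (r 0 _); rewrite -[RHS]enum_valK; case: (enum_val j).
Qed.

HB.instance Definition _ := Lmodule_hasFinDim.Build R dsum dsum_vect_axiom.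

Let ddot f g : R := \sum_i dotp (f i) (g i).

Let ddotC f g : ddot f g = ddot g f.
Proof. by apply: eq_bigr => i _; rewrite dotpC. Qed.

Let ddotP h : linear_for *%R (ddot^~ h).
Proof.
move=> a f g; rewrite /ddot mulr_sumr -big_split /=; apply: eq_bigr => i _.
by rewrite !ffunE dotpDl dotpZl.
Qed.

Let ddot_gt0 f : f != 0 -> 0 < ddot f f.
Proof.
move=> f0; rewrite lt_def sumr_ge0 ?andbT => [|i _]; last exact: dotp_ge0.
apply: contraNneq f0 => /eqP.
rewrite psumr_eq0 => [/allP f0|i _]; last exact: dotp_ge0.
apply/eqP/ffunP => i; rewrite !ffunE; apply/eqP.
by have := f0 i (mem_index_enum i); rewrite dotp_eq0.
Qed.

HB.instance Definition _ := Vector_isEuclid.Build R dsum ddotC ddotP ddot_gt0.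

Lemma dotp_dsumE f g : dotp f g = \sum_i dotp (f i) (g i).
Proof. by []. Qed.

End DirectSum.

Section Flow.
Local Open Scope classical_set_scope.
Local Open Scope ring_scope.
Variable R : realType.

Definition is_gradient (V : euclidType R) (J : V -> R) (u g : V) : Prop :=
  is_diff u (J : V -> R^o) (fun h : V => dotp g h : R^o).

(* A solution of  rho' = X(rho), rho(0) = rho0  on the whole half-line [0, +oo[,
   with the one-sided derivative at 0; the values of rho at negative times are
   irrelevant. *)
Definition is_global_solution (V : euclidType R) (X : V -> V) (rho0 : V)
    (rho : R -> V) : Prop :=
  [/\ rho 0 = rho0,
      h^-1 *: (rho h - rho 0) @[h --> 0^'+] --> X (rho 0) &
      forall t : R, 0 < t -> is_derive t 1 rho (X (rho t))].

Definition cvg_exponentially (V : euclidType R) (rho : R -> V) (l : V) : Prop :=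
  exists C lambda : R, 0 < lambda /\
    forall t, 0 <= t -> `|rho t - l| <= C * expR (- lambda * t).

End Flow.

(* Finite graphs without self-loops; simple graphs are those with [ends]
   injective. *)
Record graph := Graph {
  vert : finType ;
  edge : finType ;
  ends : edge -> {set vert} ;
  card_ends : forall e, #|ends e| = 2%N
}.

Definition endpoint (G : graph) (e : edge G) : finType := {w : vert G | w \in ends e}.

(* An orientation is given by the heads; the tail is the other endpoint. *)
Definition orientation (G : graph) := forall e : edge G, endpoint e.

Definition incidence (G : graph) : finType :=
  {p : vert G * edge G | p.1 \in ends p.2}.

Definition ivert (G : graph) (i : incidence G) : vert G := (val i).1.
Definition iedge (G : graph) (i : incidence G) : edge G := (val i).2.
Definition incid (G : graph) (e : edge G) (w : endpoint e) : incidence G :=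
  exist _ (val w, e) (valP w).

Section Sheaf.
Variables (R : realType) (G : graph).
Variables (Fv : vert G -> euclidType R) (Fe : edge G -> euclidType R).

(* A discourse sheaf with stalks [Fv] and [Fe] is the family of its restriction
   maps; the norm of the direct sum is the Frobenius norm. *)
Definition sheaf : euclidType R :=
  dsum (fun i : incidence G => 'Hom(Fv (ivert i), Fe (iedge i)) : euclidType R).

Definition cochain0 : euclidType R := dsum Fv.

Variable o : orientation G.

Definition sgn (e : edge G) (w : endpoint e) : R := if w == o e then 1 else -1.

Definition rmap (F : sheaf) (e : edge G) (w : endpoint e) :
  'Hom(Fv (val w), Fe e) := F (incid w).

Definition discrepancy (F : sheaf) (x : cochain0) (e : edge G) : Fe e :=
  \sum_(w : endpoint e) sgn w *: rmap F w (x (val w)).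

Variable I : {set incidence G}.

Definition Vmaps : euclidType R :=
  dsum (fun i : {i : incidence G | i \in I} =>
    'Hom(Fv (ivert (val i)), Fe (iedge (val i))) : euclidType R).

Definition adapting_edge : finType :=
  {e : edge G | [exists w : endpoint e, incid w \in I]}.

Definition Wspace : euclidType R := dsum (fun e : adapting_edge => Fe (val e)).

Definition adapting_discrepancy (F : sheaf) (x : cochain0) : Wspace :=
  [ffun e : adapting_edge => discrepancy F x (val e)].

Definition adapting_maps (F : sheaf) : Vmaps :=
  [ffun i : {i : incidence G | i \in I} => F (val i)].

Definition with_maps (F : sheaf) (rho : Vmaps) : sheaf :=
  [ffun i : incidence G =>
    match @idP (i \in I) with
    | ReflectT iI => rho (exist _ i iI)
    | ReflectF _ => F i
    end].

Definition same_fixed_maps (F F' : sheaf) : Prop :=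
  forall i : incidence G, i \notin I -> F' i = F i.

Definition minimizes_discrepancy (F : sheaf) (x : cochain0) (F' : sheaf) : Prop :=
  same_fixed_maps F F' /\
  forall F'' : sheaf, same_fixed_maps F F'' ->
    `|adapting_discrepancy F' x| <= `|adapting_discrepancy F'' x|.

Variable x : cochain0.

Definition armap (rho : Vmaps) (e : edge G) (w : endpoint e) (wI : incid w \in I) :
  'Hom(Fv (val w), Fe e) := rho (exist _ (incid w) wI).

(* [discop] is the operator A and [discconst] the constant c; see
   [adapting_discrepancyE]. *)
Definition discop_fun (rho : Vmaps) : Wspace :=
  [ffun e : adapting_edge =>
    \sum_(w : {w : endpoint (val e) | incid w \in I})
      sgn (val w) *: armap rho (valP w) (x (val (val w)))].

Let discop_linear : linear discop_fun.
Proof.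
move=> a r s; apply/ffunP => e; rewrite !ffunE scaler_sumr -big_split /=.
apply: eq_bigr => w _.
by rewrite /armap !ffunE add_lfunE scale_lfunE scalerDr !scalerA (mulrC a).
Qed.

HB.instance Definition _ :=
  GRing.isLinear.Build R Vmaps Wspace *:%R discop_fun discop_linear.

Definition discop : 'Hom(Vmaps, Wspace) := linfun discop_fun.

Lemma discopE rho : discop rho = discop_fun rho.
Proof. exact: lfunE. Qed.

Definition discconst (F : sheaf) : Wspace :=
  [ffun e : adapting_edge =>
    \sum_(w : endpoint (val e) | incid w \notin I)
      sgn w *: rmap F w (x (val w))].

Lemma adapting_discrepancyE (F : sheaf) (rho : Vmaps) :
  adapting_discrepancy (with_maps F rho) x = discop rho + discconst F.
Proof.
rewrite discopE; apply/ffunP => e; rewrite !ffunE /discrepancy /rmap /armap.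
rewrite (bigID (fun w => incid w \in I)) /=; congr (_ + _); last first.
  by apply: eq_bigr => w wI; rewrite ffunE; case: {-}_ / idP => // wI'; rewrite wI' in wI.
rewrite (reindex_omap val (insub : _ -> option {w | incid w \in I})) => [|w wI]; last first.
  by rewrite insubT.
apply: eq_big => [w|w _]; first by rewrite (valP w) valK eqxx.
rewrite ffunE.
case: {-}_ / idP => [wI|/(_ (valP w))//].
by rewrite (bool_irrelevance wI (valP w)).
Qed.

End Sheaf.

Section LeastSquares.
Variables (R : realType) (U V : euclidType R) (A : 'Hom(U, V)) (c : V).

Definition least_squares (rho : U) : R := 2^-1 * `|A rho + c| ^+ 2.

Definition minimizes_residual (rho : U) : Prop :=
  forall rho' : U, `|A rho + c| <= `|A rho' + c|.

End LeastSquares.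

Section Nearest.
Variables (R : realType) (V : euclidType R).

(* Strict inequality: the nearest point is unique. *)
Definition is_nearest (S : V -> Prop) (v u : V) : Prop :=
  S u /\ forall u', S u' -> u' <> u -> `|u - v| < `|u' - v|.

End Nearest.

(* Main.v *)
Require Import Defs.
From HB Require Import structures.
From mathcomp Require Import all_boot all_order all_algebra.
From mathcomp Require Import all_classical all_reals all_analysis.
From mathcomp Require Import ring lra.

(** The discrepancy flow is the gradient flow of a linear least-squares
    functional, so the theorem is about one linear map [A] between Euclidean
    spaces, a vector [c], and the point [rhoinf = rho0 - A^+ (A rho0 + c)].

    The geometry rests on two facts about [rhoinf]. It solves the normal equation
    [A^T (A rhoinf + c) = 0] ([normal_equation]), so by Pythagoras
    [|A r + c|^2 = |A (r - rhoinf)|^2 + |A rhoinf + c|^2]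
    ([residual_pythagoras]): the minimizers are exactly [rhoinf + ker A], and the
    residual at [rhoinf] vanishes as soon as it vanishes somewhere. Moreover
    [rhoinf - rho0] lies in the image of [A^+], which is orthogonal to [ker A];
    Pythagoras again makes [rhoinf] the minimizer strictly nearest to [rho0]
    ([nearest_minimizer]).

    For the dynamics, [w = rho - rhoinf] satisfies the linear equation
    [w' = N w] with [N = - beta A^T A]. A solution is [Q exp(t N) w(0)], where
    [Q = A^+ A] is the orthogonal projection on the complement of [ker A]. The
    matrix exponential is built weakly: its coordinates [<b, exp(t N) v>] are real
    power series, which can be differentiated term by term ([is_derive_exp_curve]).
    Uniqueness and the rate of convergence both come from one energy estimate
    ([norm_decay]) and the identity [<z, N z> = - beta |A z|^2]. For the difference
    of two solutions the energy does not increase, hence stays [0]. For [w], which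
    stays in the image of [Q], [|w| = |A^+ A w| <= K |A w|], and the energy decays
    exponentially.

    Finally, replacing the adapting maps of a sheaf is an isometric embedding of
    the space of adapting maps onto the sheaves with the given fixed maps
    ([norm_with_mapsB], [same_fixed_mapsP]), which transports the nearest-point
    statement from maps to sheaves. *)

Set Implicit Arguments.
Unset Strict Implicit.
Unset Printing Implicit Defensive.

Import Order.TTheory GRing.Theory Num.Theory.
Import numFieldNormedType.Exports.
Local Open Scope classical_set_scope.
Local Open Scope ring_scope.

(** * Euclidean spaces and derivatives of curves *)

Lemma is_derive_linear (R : realType) (V W : normedModType R)
    (L : {linear V -> W}) (z : R -> V) (t : R) (dz : V) :
  continuous L -> is_derive t 1 z dz -> is_derive t 1 (L \o z) (L dz).
Proof.
move=> Lc [z_der dzE].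
have quot : (fun h : R => h^-1 *: ((z \o shift t) (h *: 1) - z t)) @ 0^' --> dz.
  by rewrite -dzE; exact: z_der.
have Lquot : (fun h : R => h^-1 *: (L ((z \o shift t) (h *: 1)) - L (z t))) @ 0^'
    --> L dz.
  under eq_fun do rewrite -linearB -linearZ.
  exact: (continuous_cvg _ (Lc dz) quot).
by split; [apply/cvg_ex; exists (L dz)|exact/cvg_lim].
Qed.

Section Euclid.
Variables (R : realType) (V : euclidType R).
Implicit Types (u v w : V).

Lemma normD_sqr u v : `|u + v| ^+ 2 = `|u| ^+ 2 + 2 * dotp u v + `|v| ^+ 2.
Proof. by rewrite -!dotp_norm dotpDl !dotpDr (dotpC v u); ring. Qed.

Lemma pythagoras u v : dotp u v = 0 -> `|u + v| ^+ 2 = `|u| ^+ 2 + `|v| ^+ 2.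
Proof. by move=> uv; rewrite normD_sqr uv mulr0 addr0. Qed.

Lemma ler_norm_dotp u v : `|dotp u v| <= `|u| * `|v|.
Proof.
rewrite -(@ler_pXn2r _ 2) ?nnegrE ?mulr_ge0 // exprMn real_normK ?num_real //.
have [->|v0] := eqVneq v 0; first by rewrite dotp0r normr0 !expr0n mulr0.
have v2 : 0 < `|v| ^+ 2 by rewrite exprn_gt0 // normr_gt0.
(* [u] minus its orthogonal projection on the line of [v] *)
have := sqr_ge0 `|u + (- (dotp u v / `|v| ^+ 2)) *: v|.
rewrite normD_sqr normrZ exprMn real_normK ?num_real // dotpZr.
have v20 : `|v| ^+ 2 != 0 by rewrite gt_eqF.
rewrite (_ : _ + _ = `|u| ^+ 2 - dotp u v ^+ 2 / `|v| ^+ 2); last first.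
  by move: (`|v| ^+ 2) (dotp u v) (`|u| ^+ 2) v20 => a b c a0; field.
by rewrite subr_ge0 ler_pdivrMr.
Qed.

(** Bundled as a linear map, which the continuity and differentiation lemmas
    below expect. *)
Definition dotp_lfun w : {linear V -> R^o} :=
  HB.pack (fun v => dotp v w : R^o) (GRing.isLinear.Build R V R^o *:%R _ (dotpP w)).

Lemma dotp_continuous w : continuous (fun v => dotp v w : R^o).
Proof.
apply: (@bounded_linear_continuous _ _ _ (dotp_lfun w)).
apply/linear_boundedP; near=> r => v /=.
apply: le_trans (ler_norm_dotp v w) _; rewrite mulrC ler_wpM2r //.
Unshelve. all: by end_near. Qed.

(** Lets the derivative of [|z|^2] be computed from the scalar product rule. *)
Lemma parseval u v :
  dotp u v = \sum_(i < \dim {:V}) dotp u (onb {:V})`_i * dotp v (onb {:V})`_i.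
Proof.
rewrite {1}(onb_expand (onbP {:V}) (memvf u)) dotp_suml.
by apply: eq_bigr => i _; rewrite dotpZl (dotpC v) (dotpC u).
Qed.

Lemma is_derive_dotp (z : R -> V) (t : R) (dz w : V) : is_derive t 1 z dz ->
  is_derive t 1 (fun s => dotp (z s) w : R^o) (dotp dz w).
Proof. exact: (is_derive_linear (@dotp_continuous w : continuous (dotp_lfun w))). Qed.

Lemma is_derive_norm_sqr (z : R -> V) (t : R) (dz : V) : is_derive t 1 z dz ->
  is_derive t 1 (fun s => `|z s| ^+ 2 : R^o) (2 * dotp (z t) dz).
Proof.
move=> zd.
rewrite (_ : (fun s => _) = \sum_(i < \dim {:V})
    ((fun s => dotp (z s) (onb {:V})`_i : R^o) *
     (fun s => dotp (z s) (onb {:V})`_i : R^o))); last first.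
  by apply/funext => s; rewrite fct_sumE -dotp_norm parseval.
have -> : 2 * dotp (z t) dz =
  \sum_(i < \dim {:V}) (dotp (z t) (onb {:V})`_i *: (dotp dz (onb {:V})`_i : R^o) +
     dotp (z t) (onb {:V})`_i *: (dotp dz (onb {:V})`_i : R^o)).
  rewrite parseval mulr_sumr; apply: eq_bigr => i _.
  by rewrite -mulr2n mulr_natl.
apply: is_derive_sum => i.
by apply: is_deriveM; exact: is_derive_dotp.
Qed.

End Euclid.

Lemma lfun_bounded (R : realType) (U V : euclidType R) (f : 'Hom(U, V)) :
  exists2 K : R, 0 <= K & forall x : U, `|f x| <= K * `|x|.
Proof.
exists (\sum_(i < \dim {:U}) `|(onb {:U})`_i| * `|f (onb {:U})`_i|).
  by apply: sumr_ge0 => i _; rewrite mulr_ge0.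
move=> x; rewrite {1}(onb_expand (onbP {:U}) (memvf x)) linear_sum.
apply: le_trans (ler_norm_sum _ _ _) _; rewrite mulr_suml.
apply: ler_sum => i _; rewrite linearZ /= normrZ [leRHS]mulrAC ler_wpM2r //.
exact: ler_norm_dotp.
Qed.

Lemma lfun_continuous (R : realType) (U V : euclidType R) (f : 'Hom(U, V)) :
  continuous f.
Proof.
have [K K0 fK] := lfun_bounded f.
apply: bounded_linear_continuous; apply/linear_boundedP; near=> r => x.
by apply: le_trans (fK x) _; rewrite ler_wpM2r.
Unshelve. all: by end_near. Qed.

Lemma is_derive_scaler (R : realType) (V : normedModType R) (f : R -> R)
    (t df : R) (v : V) :
  is_derive t 1 (f : R -> R^o) df -> is_derive t 1 (fun s => f s *: v) (df *: v).
Proof.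
pose L : {linear R^o -> V} := HB.pack (fun a : R^o => a *: v)
  (GRing.isLinear.Build R R^o V *:%R (fun a : R^o => a *: v)
    (fun a x y => etrans (scalerDl v (a * x) y)
                         (congr1 (+%R^~ _) (esym (scalerA a x v))))).
by apply: (@is_derive_linear _ _ _ L); exact: scalel_continuous.
Qed.

(** A one-sided derivative at [0] is all that a solution on [0, +oo[ has there; it
    gives the one-sided continuity that the energy estimate starts from. *)
Lemma right_derivable_continuous (R : realType) (V : normedModType R)
    (z : R -> V) (l : V) :
  h^-1 *: (z h - z 0) @[h --> 0^'+] --> l -> z h @[h --> 0^'+] --> z 0.
Proof.
move=> zl.
have : h *: (h^-1 *: (z h - z 0)) + z 0 @[h --> (0 : R)^'+] --> 0 *: l + z 0.
  apply: cvgD; last exact: cvg_cst.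
  by apply: cvgZ zl; apply: cvg_at_right_filter; exact: cvg_id.
rewrite scale0r add0r; apply: cvg_trans; apply: near_eq_cvg; near=> h.
by rewrite scalerA divff ?scale1r ?subrK // gt_eqF.
Unshelve. all: by end_near. Qed.

(** * Energy estimate *)

(** Gronwall's inequality for the energy [|z|^2]: the hypothesis says that
    [(|z|^2)' <= - 2 k |z|^2], so [exp(2 k t) |z|^2] does not increase. *)
Lemma norm_decay (R : realType) (V : euclidType R) (z dz : R -> V) (k : R) :
    z h @[h --> 0^'+] --> z 0 ->
    (forall t : R, 0 < t -> is_derive t 1 z (dz t)) ->
    (forall t : R, 0 < t -> dotp (z t) (dz t) <= - k * `|z t| ^+ 2) ->
  forall t : R, 0 <= t -> `|z t| <= `|z 0| * expR (- k * t).
Proof.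
move=> z0 zD zk t t0.
pose g (s : R) : R := expR (2 * k * s) * `|z s| ^+ 2.
have gD (s : R) : 0 < s -> is_derive s 1 g
    (expR (2 * k * s) * (2 * (dotp (z s) (dz s) + k * `|z s| ^+ 2))).
  move=> s0; have n2 := is_derive_norm_sqr (zD s s0).
  have lin : is_derive s 1 (fun r : R => 2 * k * r) (2 * k).
    by apply: is_derive_eq; rewrite [_ *: 1]mulr1.
  have e2 : is_derive s 1 (fun r : R => expR (2 * k * r))
      (expR (2 * k * s) * (2 * k)).
    exact: (is_derive1_comp (is_derive_expR _) lin).
  by apply: is_derive_eq; rewrite /GRing.scale /=; ring.
have g_noninc : g t <= g 0.
  apply: (@ler0_derive1_nincry _ g 0) => //.
  - by move=> s; rewrite in_itv /= andbT => /gD[].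
  - move=> s; rewrite in_itv /= andbT => s0; rewrite derive1E.
    have [_ ->] := gD s s0; rewrite pmulr_rle0 ?expR_gt0 // pmulr_rle0 //.
    by have := zk s s0; rewrite mulNr => ?; lra.
  apply/continuous_within_itvcyP; split.
    move=> s; rewrite in_itv /= andbT => /gD[/derivable1_diffP sD _].
    exact: differentiable_continuous.
  apply: cvgM; last first.
    by apply: cvgM; apply: cvg_norm.
  apply: cvg_at_right_filter; apply: continuous_comp; last exact: continuous_expR.
  exact: mulrl_continuous.
rewrite -(@ler_pXn2r _ 2) ?nnegrE ?mulr_ge0 ?expR_ge0 // exprMn -expRM_natl.
rewrite -(ler_pM2l (expR_gt0 (2 * k * t))).
rewrite [leRHS](_ : _ = `|z 0| ^+ 2); last first.
  rewrite mulrCA -expRD (_ : _ + _ = 0) ?expR0 ?mulr1 //; ring.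
by move: g_noninc; rewrite /g mulr0 expR0 mul1r.
Qed.

(** * The exponential of an endomorphism *)

Section Exponential.
Variables (R : realType) (V : euclidType R) (M : 'End(V)).
Implicit Types (b v : V) (s t : R).

(** The Taylor coefficients of the scalar function [t |-> <b, exp(t M) v>]. *)
Definition expc b v : R^nat := fun n => dotp b (iter n M v) / n`!%:R.

(** Term-by-term differentiation amounts to replacing [v] by [M v]. *)
Lemma pseries_diffs_expc b v : pseries_diffs (expc b v) = expc b (M v).
Proof.
apply/funext => n; rewrite /pseries_diffs /expc -iterSr factS natrM.
by rewrite invfM mulrCA mulVKf.
Qed.

(** The series is dominated by the exponential series at [K |t|], where [K] bounds
    [M]. *)
Lemma is_cvg_expc b v t : cvgn (pseries (expc b v) t).
Proof.
have [K K0 KM] := lfun_bounded M.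
have Kn n : `|iter n M v| <= K ^+ n * `|v|.
  elim: n => [|n IHn] /=; first by rewrite expr0 mul1r.
  by apply: le_trans (KM _) _; rewrite exprS -mulrA ler_wpM2l.
apply: normed_cvg.
apply: (@series_le_cvg _ _ ((`|b| * `|v|) *: exp_coeff (K * `|t|))) => [//=|n|n|].
- by apply: mulr_ge0; [exact: mulr_ge0|apply: exp_coeff_ge0; exact: mulr_ge0].
- rewrite /= -[leRHS]/((`|b| * `|v|) * ((K * `|t|) ^+ n / n`!%:R)) /expc.
  rewrite !normrM normfV normrX [`|_%:R|]ger0_norm //.
  rewrite mulrAC exprMn [leRHS]mulrA ler_wpM2r ?invr_ge0 //.
  rewrite [leRHS]mulrA ler_wpM2r ?exprn_ge0 //.
  apply: le_trans (ler_norm_dotp _ _) _; rewrite -mulrA ler_wpM2l // mulrC.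
  exact: Kn.
by apply: is_cvg_seriesZ; exact: is_cvg_series_exp_coeff.
Qed.

Definition dotp_exp b v t : R := limn (pseries (expc b v) t).

Lemma is_derive_dotp_exp b v (t : R) :
  is_derive (t : R) 1 (dotp_exp b v : R -> R^o) (dotp_exp b (M v) t).
Proof.
rewrite /dotp_exp -pseries_diffs_expc.
(* any radius beyond [|t|] will do *)
apply: (@pseries_snd_diffs _ _ (`|t| + 1));
  rewrite ?pseries_diffs_expc; try exact: is_cvg_expc.
by rewrite [ltRHS]ger0_norm ?addr_ge0 // ltrDl.
Qed.

Lemma dotp_exp0 b v : dotp_exp b v 0 = dotp b v.
Proof.
apply: lim_near_cst => //; near=> m.
rewrite /pseries /series /= -[m]prednK; last by near: m.
rewrite big_nat_recl //= big1 ?addr0 => [|i _].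
  by rewrite /expc /= fact0 expr0 mulr1 invr1 mulr1.
by rewrite expr0n mulr0.
Unshelve. all: by end_near. Qed.

Lemma dotp_exp_linear v t : linear (fun b => dotp_exp b v t : R^o).
Proof.
move=> a b c; rewrite /dotp_exp -lim_seriesZ; last exact: is_cvg_expc.
rewrite -lim_seriesD;
  [|by apply: is_cvg_seriesZ; exact: is_cvg_expc|exact: is_cvg_expc].
congr (limn _); rewrite /pseries; congr (series _); apply/funext => n.
rewrite /expc !fctE. rewrite /= dotpDl dotpZl /GRing.scale /=; ring.
Qed.

Lemma dotp_expM b v t : dotp_exp b (M v) t = dotp_exp (adjoint M b) v t.
Proof.
congr (limn (pseries _ _)); apply/funext => n.
by rewrite /expc -iterSr iterS dotpC adjointP dotpC.
Qed.

Definition exp_curve v t : V :=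
  \sum_(i < \dim {:V}) dotp_exp (onb {:V})`_i v t *: (onb {:V})`_i.

(** The coordinates of [exp(t M) v] determine all its inner products, because
    the defining series are linear in [b]. *)
Lemma dotp_exp_curve b v t : dotp b (exp_curve v t) = dotp_exp b v t.
Proof.
pose L : {linear V -> R^o} := HB.pack (fun b => dotp_exp b v t : R^o)
  (GRing.isLinear.Build R V R^o *:%R _ (dotp_exp_linear v t)).
rewrite /exp_curve dotp_sumr -[RHS]/(L b).
rewrite [in RHS](onb_expand (onbP {:V}) (memvf b)) linear_sum.
by apply: eq_bigr => i _; rewrite linearZ dotpZr mulrC (dotpC b).
Qed.

Lemma exp_curve0 v : exp_curve v 0 = v.
Proof. by apply: dotpI => b; rewrite dotpC dotp_exp_curve dotp_exp0 dotpC. Qed.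

Lemma is_derive_exp_curve v (t : R) :
  is_derive t 1 (exp_curve v) (M (exp_curve v t)).
Proof.
have -> : M (exp_curve v t) =
    \sum_(i < \dim {:V}) dotp_exp (onb {:V})`_i (M v) t *: (onb {:V})`_i.
  rewrite [LHS](onb_expand (onbP {:V}) (memvf _)); apply: eq_bigr => i _.
  by rewrite dotpC adjointP dotpC dotp_exp_curve dotp_expM.
rewrite (_ : exp_curve v = \sum_(i < \dim {:V})
    (fun s => dotp_exp (onb {:V})`_i v s *: (onb {:V})`_i)); last first.
  by apply/funext => s; rewrite fct_sumE.
by apply: is_derive_sum => i; apply: is_derive_scaler; exact: is_derive_dotp_exp.
Qed.

End Exponential.

(** * The pseudoinverse *)

Section PseudoInverse.
Variables (R : realType) (U V : euclidType R) (A : 'Hom(U, V)).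
Implicit Types (u : U) (v : V).

Lemma mpinvK u : A (mpinv A (A u)) = A u.
Proof. by have [AgA _ _ _] := mpinvP A; rewrite -[in RHS]AgA !comp_lfunE. Qed.

Lemma mpinvVK v : mpinv A (A (mpinv A v)) = mpinv A v.
Proof. by have [_ gAg _ _] := mpinvP A; rewrite -[in RHS]gAg !comp_lfunE. Qed.

Lemma mpinv_dom_sym u u' :
  dotp (mpinv A (A u)) u' = dotp u (mpinv A (A u')).
Proof.
have [_ _ _ sym] := mpinvP A.
by rewrite -!(comp_lfunE (mpinv A) A) adjointP sym.
Qed.

Lemma mpinv_codom_sym v v' :
  dotp (A (mpinv A v)) v' = dotp v (A (mpinv A v')).
Proof.
have [_ _ sym _] := mpinvP A.
by rewrite -!(comp_lfunE A (mpinv A)) adjointP sym.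
Qed.

(** [A A^+] is self-adjoint, so this is the adjoint of [A A^+ A = A]. *)
Lemma adjoint_mpinv v : adjoint A (A (mpinv A v)) = adjoint A v.
Proof.
by apply: dotpI => u; rewrite dotpC -adjointP -mpinv_codom_sym mpinvK adjointP dotpC.
Qed.

(** [A^+ A] is self-adjoint, so this too is the adjoint of [A A^+ A = A]. *)
Lemma mpinv_adjoint v : mpinv A (A (adjoint A v)) = adjoint A v.
Proof.
apply: dotpI => u.
by rewrite mpinv_dom_sym dotpC -adjointP mpinvK adjointP dotpC.
Qed.

(** Since [A^+ v = (A^+ A) (A^+ v)], moving the self-adjoint [A^+ A] to the other
    side makes it act on [u], where it vanishes. *)
Lemma mpinv_orth_ker u v : A u = 0 -> dotp u (mpinv A v) = 0.
Proof. by move=> Au; rewrite -mpinvVK -mpinv_dom_sym Au linear0 dotp0l. Qed.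

End PseudoInverse.

(** * Least squares *)

Section LeastSquares.
Variables (R : realType) (U V : euclidType R) (A : 'Hom(U, V)) (c : V).
Implicit Types (r : U).

(** Expanding the square, the remainder after the linear term is
    [|A h|^2 / 2 <= K^2 |h|^2 / 2], which is o(h). *)
Lemma least_squares_gradient r :
  is_gradient (least_squares A c) r (adjoint A (A r + c)).
Proof.
set g := adjoint A (A r + c); pose dJ := dotp_lfun g.
have [K K0 AK] := lfun_bounded A.
have K1 : 0 < K ^+ 2 + 1 by rewrite ltr_wpDl ?sqr_ge0.
have dJc : continuous dJ by exact: dotp_continuous.
have dJE : (fun h : U => dotp g h : R^o) = dJ.
  by apply/funext => h; rewrite /= dotpC.
have expand : (least_squares A c : U -> R^o) \o shift r =
    cst (least_squares A c r : R^o) + dJ +o_ (0 : U) id.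
  apply/eqaddoP => e e0; near=> h.
  have -> : ((least_squares A c : U -> R^o) \o shift r -
      (cst (least_squares A c r : R^o) + (dJ : U -> R^o))) h = 2^-1 * `|A h| ^+ 2.
    rewrite !fctE /= /least_squares linearD /= -addrA normD_sqr adjointP -/g; lra.
  have hK : `|h| * (K ^+ 2 + 1) <= e.
    by rewrite -ler_pdivlMr //; near: h; apply: nbhs0_le; rewrite divr_gt0.
  rewrite ger0_norm ?mulr_ge0 // /=.
  apply: le_trans (_ : (K * `|h|) ^+ 2 <= _); last first.
    rewrite exprMn expr2 mulrA ler_wpM2r // mulrC; apply: le_trans hK.
    by rewrite ler_wpM2l // lerDl.
  apply: le_trans (_ : `|A h| ^+ 2 <= _); last first.
    by rewrite ler_pXn2r ?nnegrE ?mulr_ge0.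
  by rewrite ler_piMl ?sqr_ge0 // invf_le1 // ler1n.
rewrite /is_gradient dJE.
have dE := diff_unique dJc expand.
split=> //; apply/diff_locallyP; split; last by rewrite dE.
by move=> x; rewrite dE; exact: dJc.
Unshelve. all: by end_near. Qed.

Variable rho0 : U.
Let rhoinf := rho0 - mpinv A (A rho0 + c).

Lemma normal_equation : adjoint A (A rhoinf + c) = 0.
Proof. by rewrite /rhoinf linearB /= addrAC linearB /= adjoint_mpinv subrr. Qed.

(** The normal equation says that [A rhoinf + c] is orthogonal to the image of
    [A]. *)
Lemma residual_pythagoras r :
  `|A r + c| ^+ 2 = `|A (r - rhoinf)| ^+ 2 + `|A rhoinf + c| ^+ 2.
Proof.
rewrite -pythagoras; first by rewrite linearB /= addrA subrK.
by rewrite adjointP normal_equation dotp0r.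
Qed.

Lemma minimizes_residualP r : minimizes_residual A c r <-> A (r - rhoinf) = 0.
Proof.
split=> [/(_ rhoinf)|Ar r'].
  rewrite -(@ler_pXn2r _ 2) ?nnegrE // residual_pythagoras gerDr => le0.
  by apply/eqP; rewrite -normr_eq0 -sqrf_eq0 eq_le le0 sqr_ge0.
rewrite -(@ler_pXn2r _ 2) ?nnegrE // (residual_pythagoras r).
rewrite (residual_pythagoras r') Ar normr0.
by rewrite expr0n add0r lerDr sqr_ge0.
Qed.

(** A minimizer [r] differs from [rhoinf] by an element of [ker A], while
    [rhoinf - rho0] is orthogonal to [ker A]. *)
Lemma nearest_minimizer : is_nearest (minimizes_residual A c) rho0 rhoinf.
Proof.
split=> [|r]; first by apply/minimizes_residualP; rewrite subrr linear0.
move=> /minimizes_residualP Ar rN.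
have -> : r - rho0 = (r - rhoinf) + (rhoinf - rho0) by rewrite addrA subrK.
have orth : dotp (r - rhoinf) (rhoinf - rho0) = 0.
  have -> : rhoinf - rho0 = -1 *: mpinv A (A rho0 + c).
    by rewrite scaleN1r /rhoinf addrAC subrr sub0r.
  by rewrite dotpZr mpinv_orth_ker ?mulr0.
rewrite -(@ltr_pXn2r _ 2) ?nnegrE // (pythagoras orth) ltrDr exprn_gt0 //.
by rewrite normr_gt0 subr_eq0; exact/eqP.
Qed.

Lemma residual0 : - c \in limg A -> A rhoinf + c = 0.
Proof.
move=> /memv_imgP[u _ cE].
have := residual_pythagoras u; rewrite -cE addNr normr0 expr0n /= => /esym/eqP.
rewrite paddr_eq0 ?sqr_ge0 // => /andP[_].
by rewrite sqrf_eq0 normr_eq0 => /eqP.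
Qed.

(** * The gradient flow *)

Section Flow.
Variables (beta : R) (beta_gt0 : 0 < beta).
Let flow r : U := - beta *: adjoint A (A r + c).

Lemma flowB r r' : flow r - flow r' = - beta *: adjoint A (A (r - r')).
Proof. by rewrite /flow -scalerBr -linearB /= opprD addrACA subrr addr0 -linearB. Qed.

Lemma dotp_flowB r r' :
  dotp (r - r') (flow r - flow r') = - beta * `|A (r - r')| ^+ 2.
Proof. by rewrite flowB dotpZr -adjointP dotp_norm. Qed.

(** By [dotp_flowB] the distance between two solutions does not increase. *)
Lemma flow_unique rho rho' : is_global_solution flow rho0 rho ->
  is_global_solution flow rho0 rho' -> forall t : R, 0 <= t -> rho' t = rho t.
Proof.
move=> [r0 rc rD] [r0' rc' rD'] t t0.
have := @norm_decay _ _ (fun t => rho' t - rho t)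
  (fun t => flow (rho' t) - flow (rho t)) 0.
rewrite r0 r0' subrr normr0 => /(_ _ _ _ t t0).
rewrite mul0r normr_le0 subr_eq0 => H; apply/eqP/H => [|s s0|s s0].
- have := cvgB (right_derivable_continuous rc') (right_derivable_continuous rc).
  by rewrite r0 r0' subrr; apply.
- by have := rD' s s0; have := rD s s0 => *; exact: is_deriveB.
by rewrite dotp_flowB oppr0 mul0r mulNr oppr_le0 mulr_ge0 ?sqr_ge0 ?(ltW beta_gt0).
Qed.

(** Composing with the projection [Q] keeps [w] orthogonal to [ker A] by
    construction; [w] still solves [w' = N w] because [Q N = N = N Q]. *)
Let Q : 'End(U) := (mpinv A \o A)%VF.
Let N : 'End(U) := (- beta *: (adjoint A \o A))%VF.
Let w t := Q (exp_curve N (mpinv A (A rho0 + c)) t).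
Definition flow_sol t : U := rhoinf + w t.

Lemma flow_sol_deriv (t : R) : is_derive t 1 flow_sol (flow (flow_sol t)).
Proof.
have flow0 : flow rhoinf = 0 by rewrite /flow normal_equation scaler0.
have NE u : N u = - beta *: adjoint A (A u) by rewrite scale_lfunE comp_lfunE.
have wD := is_derive_linear (@lfun_continuous _ _ _ Q)
  (is_derive_exp_curve N (mpinv A (A rho0 + c)) t).
have := is_deriveD (is_derive_cst rhoinf t 1) wD.
rewrite add0r => /is_derive_eq; apply.
rewrite -[RHS]subr0 -flow0 flowB addrAC subrr add0r /w NE linearZ /= !comp_lfunE.
by rewrite mpinv_adjoint mpinvK.
Qed.

(** The exponential rate is [beta / (K^2 + 1)], where [K] bounds [A^+]: on the
    image of [Q] this gives [|w|^2 <= (K^2 + 1) |A w|^2]. *)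
Lemma flow_exists : exists rho : R -> U,
  is_global_solution flow rho0 rho /\ cvg_exponentially rho rhoinf.
Proof.
have sol0 : flow_sol 0 = rho0.
  by rewrite /flow_sol /w exp_curve0 comp_lfunE mpinvVK subrK.
exists flow_sol; split.
  split=> // [|t _]; last exact: flow_sol_deriv.
  apply: cvg_dnbhs_at_right; have [d0 d0E] := flow_sol_deriv 0.
  have : h^-1 *: ((flow_sol \o shift 0) (h *: 1) - flow_sol 0) @[h --> 0^'] -->
      flow (flow_sol 0) by rewrite -d0E; exact: d0.
  by under eq_fun do rewrite /= addr0 [_ *: 1]mulr1.
have [K K0 AK] := lfun_bounded (mpinv A).
(* the summand [1] keeps the denominator positive when [K = 0] *)
exists `|flow_sol 0 - rhoinf|, (beta / (K ^+ 2 + 1)).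
have K1 : 0 < K ^+ 2 + 1 by rewrite ltr_wpDl ?sqr_ge0.
split=> [|t t0]; first exact: divr_gt0.
apply: (@norm_decay _ _ (fun t => flow_sol t - rhoinf) (fun t => flow (flow_sol t)))
  t0 => [|s _|s _].
- apply: cvgB; last exact: cvg_cst.
  apply: cvg_at_right_filter.
  by have [/derivable1_diffP/differentiable_continuous] := flow_sol_deriv 0.
- have := is_deriveB (flow_sol_deriv s) (is_derive_cst rhoinf s 1).
  by rewrite subr0.
have flow0 : flow rhoinf = 0 by rewrite /flow normal_equation scaler0.
rewrite -[flow _]subr0 -flow0 dotp_flowB.
have ws : flow_sol s - rhoinf = mpinv A (A (flow_sol s - rhoinf)).
  by rewrite /flow_sol addrAC subrr add0r /w !comp_lfunE mpinvVK.
set y := flow_sol s - rhoinf in ws *.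
have : `|y| <= K * `|A y| by rewrite {1}ws; exact: AK.
rewrite -(@ler_pXn2r _ 2) ?nnegrE ?mulr_ge0 // exprMn => yK.
rewrite !mulNr lerN2 -mulrA ler_wpM2l ?(ltW beta_gt0) // mulrC ler_pdivrMr //.
by apply: le_trans yK _; rewrite mulrC ler_wpM2l ?sqr_ge0 // lerDl.
Qed.

End Flow.

End LeastSquares.

(** * Sheaves with prescribed fixed maps *)

Lemma dsumBE (R : realType) (I : finType) (T : I -> euclidType R)
  (f g : dsum T) i : (f - g) i = f i - g i.
Proof. by rewrite !ffunE. Qed.

Section SheafMaps.
Variables (R : realType) (G : graph).
Variables (Fv : vert G -> euclidType R) (Fe : edge G -> euclidType R).
Variable I : {set incidence G}.
Implicit Types (F : sheaf Fv Fe) (r : Vmaps Fv Fe I).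

Lemma with_maps_val F r (i : {i : incidence G | i \in I}) :
  with_maps F r (val i) = r i.
Proof.
case: i => i iI; rewrite /= ffunE; case: {-}_ / idP => [iI'|/(_ iI)//].
by congr (r (exist _ i _)); exact: bool_irrelevance.
Qed.

Lemma with_maps_fixed F r (i : incidence G) : i \notin I -> with_maps F r i = F i.
Proof. by move=> iI; rewrite ffunE; case: {-}_ / idP => // iI'; rewrite iI' in iI. Qed.

Lemma same_fixed_mapsP F F' :
  same_fixed_maps I F F' <-> exists r, F' = with_maps F r.
Proof.
split=> [FF'|[r ->] i iI]; last exact: with_maps_fixed.
exists (adapting_maps I F'); apply/ffunP => i.
have [iI|iI] := boolP (i \in I); last by rewrite with_maps_fixed ?FF'.
by rewrite -[i]/(val (exist (fun i => i \in I) i iI)) with_maps_val ffunE.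
Qed.

(** The incidences outside [I] contribute [0] to the Frobenius distance. *)
Lemma norm_with_mapsB F r : `|with_maps F r - F| = `|r - adapting_maps I F|.
Proof.
apply/eqP; rewrite -(@eqrXn2 _ 2) //; apply/eqP.
rewrite -!dotp_norm !dotp_dsumE (bigID (fun i => i \in I)) /=.
rewrite [X in _ + X]big1 ?addr0 => [|i iI]; last first.
  by rewrite dsumBE with_maps_fixed // subrr dotp0l.
pose toI := insub : incidence G -> option {i : incidence G | i \in I}.
rewrite (reindex_omap val toI) => [|i iI]; last by rewrite /toI insubT.
apply: eq_big => [i|i _]; first by rewrite (valP i) /toI valK eqxx.
by rewrite !dsumBE with_maps_val ffunE.
Qed.

Variables (o : orientation G) (x : cochain0 Fv).

Lemma minimizes_discrepancyP F F' :
  minimizes_discrepancy o I F x F' <->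
  exists2 r, F' = with_maps F r &
    minimizes_residual (discop Fe o I x) (discconst o I x F) r.
Proof.
split=> [[/same_fixed_mapsP[r ->] F'min]|[r -> rmin]].
  exists r => // r'; rewrite -!adapting_discrepancyE; apply: F'min.
  by apply/same_fixed_mapsP; exists r'.
split=> [|_ /same_fixed_mapsP[r' ->]]; first by apply/same_fixed_mapsP; exists r.
by rewrite !adapting_discrepancyE.
Qed.

Lemma nearest_with_maps F r :
  is_nearest (minimizes_residual (discop Fe o I x) (discconst o I x F))
    (adapting_maps I F) r ->
  is_nearest (minimizes_discrepancy o I F x) F (with_maps F r).
Proof.
move=> [rmin rnear]; split=> [|_ /minimizes_discrepancyP[r' -> r'min] r'N].
  by apply/minimizes_discrepancyP; exists r.
by rewrite !norm_with_mapsB; apply: rnear => // rr'; apply: r'N; rewrite rr'.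
Qed.

End SheafMaps.

Local Close Scope classical_set_scope.

(** * Convergence of the discrepancy flow *)

Theorem theorem4p1 (R : realType) (G : graph)
    (Fv : vert G -> euclidType R) (Fe : edge G -> euclidType R)
    (F : sheaf Fv Fe) (x : cochain0 Fv) (o : orientation G)
    (I : {set incidence G}) (beta : R) (beta_gt0 : 0 < beta) :
  let A := discop Fe o I x in
  let c := discconst o I x F in
  let rho0 := adapting_maps I F in
  let J := least_squares A c in
  let flow := fun r : Vmaps Fv Fe I => - beta *: adjoint A (A r + c) in
  let d0 := A rho0 + c in
  let rhoinf := rho0 - mpinv A d0 in
  let Finf := with_maps F rhoinf in
  [/\ forall r : Vmaps Fv Fe I, is_gradient J r (adjoint A (A r + c)),
      exists rho : R -> Vmaps Fv Fe I,
        [/\ is_global_solution flow rho0 rho,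
            forall rho' : R -> Vmaps Fv Fe I, is_global_solution flow rho0 rho' ->
              forall t : R, 0 <= t -> rho' t = rho t &
            cvg_exponentially rho rhoinf],
      is_nearest (minimizes_discrepancy o I F x) F Finf,
      is_nearest (minimizes_residual A c) rho0 rhoinf &
      (- c \in limg A ->
         (forall e : adapting_edge I, discrepancy o Finf x (val e) = 0) /\
         A rhoinf + c = 0) /\
      (- c \notin limg A -> minimizes_residual A c rhoinf)].
Proof.
move=> A c rho0 J flow d0 rhoinf Finf.
have rho_near : is_nearest (minimizes_residual A c) rho0 rhoinf.
  exact: nearest_minimizer.
split=> //.
- exact: least_squares_gradient.
- have [rho [rho_sol rho_cvg]] := flow_exists A c rho0 beta_gt0.
  exists rho; split=> // rho' rho'_sol t t0.
  exact: (flow_unique beta_gt0 rho_sol rho'_sol).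
- exact: nearest_with_maps.
split=> [cA|_]; last by have [] := rho_near.
have Ac0 : A rhoinf + c = 0 by exact: residual0.
split=> // e.
transitivity (adapting_discrepancy o I Finf x e); first by rewrite ffunE.
by rewrite adapting_discrepancyE -/A -/c Ac0 ffunE.
Qed.
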